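(* Let $(S,+,* )$ be a congruence-simple semiring with an additively neutral element $0$ (that is, $0+x=x=x+0$ for all $x\in S$). Then $(S,+)$ is either idempotent (that is, $a+a=a$ for all $a\in S$) or a group.
   Context: A semiring here is a non-empty set $S$ with two binary operations $+$ and $*$ such that $(S,+)$ is associative and commutative and $a*(b+c)=a*b+a*c$, $(a+b)*c=a*c+b*c$ for all $a,b,c\in S$. The multiplication $*$ is not assumed to be associative or commutative, and the neutral element $0$ is not assumed to be multiplicatively absorbing. A congruence of $(S,+,* )$ is an equivalence relation $\rho$ on $S$ such that $\rho(a,b)$ implies $\rho(x+a,x+b)$, $\rho(a+x,b+x)$, $\rho(x*a,x*b)$ and $\rho(a*x,b*x)$ for all $a,b,x\in S$. The semiring is congruence-simple if its only congruences are $\mathrm{id}_S=\{(a,a)\mid a\in S\}$ and $S\times S$. *)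

(* Defs.v *)
From Stdlib Require Import RelationClasses.
From mathcomp Require Import ssreflect ssrfun ssrbool.

Set Implicit Arguments.
Unset Strict Implicit.
Unset Printing Implicit Defensive.

(* The algebraic structures of MathComp all extend choiceType, and its
   semirings are associative with an absorbing zero; the carrier here is an
   arbitrary non-empty type with two operations. *)

Record is_semiring (S : Type) (add mul : S -> S -> S) : Prop := {
  semiring_inhabited : inhabited S;
  semiring_addA : associative add;
  semiring_addC : commutative add;
  semiring_mulDr : right_distributive mul add;
  semiring_mulDl : left_distributive mul add
}.

Record is_congruence (S : Type) (add mul : S -> S -> S)
    (rho : S -> S -> Prop) : Prop := {
  congruence_equiv : Equivalence rho;
  congruence_addl : forall a b x, rho a b -> rho (add x a) (add x b);
  congruence_addr : forall a b x, rho a b -> rho (add a x) (add b x);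
  congruence_mull : forall a b x, rho a b -> rho (mul x a) (mul x b);
  congruence_mulr : forall a b x, rho a b -> rho (mul a x) (mul b x)
}.

(* A one-element semiring is congruence-simple: the two trivial congruences
   are not required to be distinct. *)
Definition congruence_simple (S : Type) (add mul : S -> S -> S) : Prop :=
  forall rho : S -> S -> Prop, is_congruence add mul rho ->
    (forall a b, rho a b <-> a = b) \/ (forall a b, rho a b).

Definition is_group (S : Type) (op : S -> S -> S) : Prop :=
  associative op /\
  exists e : S, [/\ left_id e op, right_id e op &
    forall x, exists y, op y x = e /\ op x y = e].

(* Main.v *)
Require Import Defs.
From mathcomp Require Import ssreflect ssrfun ssrbool.

(** Call a set of elements a face if it contains a sum exactly when it contains
    both summands. Preimages of faces under additive maps are faces, so lying
    in the same faces is a congruence. It always relates [a] to [a + a], so if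
    it is the equality then addition is idempotent. The additively invertible
    elements form a face containing [0], so if it is the full relation then
    every element is invertible. *)

Set Implicit Arguments.

Definition is_face (S : Type) (add : S -> S -> S) (F : S -> Prop) : Prop :=
  forall a b, F (add a b) <-> F a /\ F b.

Definition same_faces (S : Type) (add : S -> S -> S) (a b : S) : Prop :=
  forall F, is_face add F -> (F a <-> F b).

Lemma same_faces_morph (S : Type) (add : S -> S -> S) (f : S -> S) (a b : S) :
  {morph f : x y / add x y} -> same_faces add a b -> same_faces add (f a) (f b).
Proof.
move=> fD ab F faceF; apply: (ab (fun x => F (f x))) => x y.
by rewrite fD; apply: faceF.
Qed.

Lemma same_faces_congruence (S : Type) (add mul : S -> S -> S) :
  right_distributive mul add -> left_distributive mul add ->
  is_congruence add mul (same_faces add).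
Proof.
move=> mulDr mulDl; split.
- split.
  + by move=> a F _.
  + by move=> a b ab F faceF; have := ab F faceF; tauto.
  + move=> a b c ab bc F faceF.
    by have := ab F faceF; have := bc F faceF; tauto.
(* Translations need not be additive maps, so the face condition is applied directly to [add x a]
   and [add x b]. *)
- move=> a b x ab F faceF; have := ab F faceF.
  by have := faceF x a; have := faceF x b; tauto.
- move=> a b x ab F faceF; have := ab F faceF.
  by have := faceF a x; have := faceF b x; tauto.
(* Distributivity makes each one-sided multiplication additive. *)
- by move=> a b x; apply: same_faces_morph => y z; apply: mulDr.
- move=> a b x; apply: (@same_faces_morph _ _ (fun y => mul y x)) => y z.
  exact: mulDl.
Qed.

Lemma same_faces_double (S : Type) (add : S -> S -> S) (a : S) :
  same_faces add (add a a) a.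
Proof. by move=> F faceF; have := faceF a a; tauto. Qed.

(** A negative of [add a b] plus one summand is a negative of the other; conversely, negatives add
    up. *)
Lemma invertible_face (S : Type) (add : S -> S -> S) (zero : S) :
  associative add -> commutative add -> left_id zero add ->
  is_face add (fun x => exists y, add x y = zero).
Proof.
move=> addA addC add0 a b; split=> [[y aby0]|[[y ay0] [z bz0]]].
- split; first by exists (add b y); rewrite addA.
  by exists (add a y); rewrite addA (addC b).
- exists (add z y).
  by rewrite -addA (addA b) bz0 add0.
Qed.

Theorem corollary4p4 (S : Type) (add mul : S -> S -> S) (zero : S)
    (hS : is_semiring add mul)
    (hsimple : congruence_simple add mul)
    (zero_addl : left_id zero add)
    (zero_addr : right_id zero add) :
  (forall a : S, add a a = a) \/ is_group add.
Proof.
case: hS => _ addA addC mulDr mulDl.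
have [eqF|allF] := hsimple _ (same_faces_congruence mulDr mulDl).
- by left=> a; apply/eqF; apply: same_faces_double.
- right; split=> //; exists zero; split=> // x.
  have [y xy0] : exists y, add x y = zero.
    (* [x] shares every face with [zero], which is its own negative. *)
    apply/(allF zero x _ (invertible_face addA addC zero_addl)).
    by exists zero.
  by exists y; rewrite addC.
Qed.
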